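(* Let $\alpha>-1$ and $t>0$. The kernel of the heat semigroup $e^{-tH_\alpha}$ is given by $$e^{-tH_\alpha}(n,m)=e^{-tH_\alpha}(m,n)=\frac{1}{(1+t)^{1+\alpha}}\left(\frac{t-1}{t+1}\right)^n\left(\frac{t}{t+1}\right)^{m-n}\frac{\sigma_\alpha(m)}{\sigma_\alpha(n)}\,P_n^{(\alpha,m-n)}\left(\frac{t^2+1}{t^2-1}\right)$$ for all $n,m\in\mathbb{Z}_{\ge 0}$.
   Context: For $\alpha>-1$ and a complex sequence $u=(u_n)_{n\ge 0}$ (with $u_{-1}:=0$) put $$(\tau_\alpha u)_n=-\sqrt{n(n+\alpha)}\,u_{n-1}+(2n+1+\alpha)u_n-\sqrt{(n+1)(n+1+\alpha)}\,u_{n+1},\quad n\ge 0.$$ The discrete Laguerre operator $H_\alpha$ in $\ell^2(\mathbb{Z}_{\ge 0})$ is $H_\alpha u=\tau_\alpha u$ with domain $\{u\in\ell^2(\mathbb{Z}_{\ge0}) : \tau_\alpha u\in\ell^2(\mathbb{Z}_{\ge0})\}$; it is self-adjoint and nonnegative. $\delta_n$ denotes the $n$-th standard basis vector of $\ell^2(\mathbb{Z}_{\ge0})$ and $e^{-tH_\alpha}(n,m):=\langle e^{-tH_\alpha}\delta_n,\delta_m\rangle_{\ell^2}$. $(x)_0:=1$, $(x)_n:=x(x+1)\cdots(x+n-1)$ for $n\ge1$; $\sigma_\alpha(n):=\binom{n+\alpha}{n}^{1/2}=\left(\frac{(\alpha+1)_n}{n!}\right)^{1/2}$. $P_n^{(\alpha,\beta)}$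 are the Jacobi polynomials, normalized by $P_n^{(\alpha,\beta)}(1)=\frac{(\alpha+1)_n}{n!}$ and given by $$P_n^{(\alpha,\beta)}(x)=\frac{(\alpha+1)_n}{n!}\sum_{k=0}^n\frac{(-n)_k\,(n+\alpha+\beta+1)_k}{(\alpha+1)_k\,k!}\left(\frac{1-x}{2}\right)^k ;$$ this formula is used as the definition also when $\beta=m-n$ is a negative integer. At $t=1$ the right-hand side of the claimed formula, in which the factor $(t-1)^n$ cancels the pole of the polynomial of degree at most $n$ in $\frac{t^2+1}{t^2-1}$, is understood by continuous extension in $t$. *)

(* Defs.v *)
From Stdlib Require Import Reals ZArith.
From Coquelicot Require Import Coquelicot.
Open Scope R_scope.

(** * The Hilbert space l^2(Z_{>=0}) of complex sequences *)

Definition cseq : Type := nat -> C.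

Definition ell2 (u : cseq) : Prop := ex_series (fun n => Cmod (u n) ^ 2).

(** [norm2] and [inner] are total; they carry their meaning on [ell2] only. *)
Definition norm2 (u : cseq) : R := sqrt (Series (fun n => Cmod (u n) ^ 2)).

(** Linear in the first argument. [Series] being real-valued, the real and
    imaginary parts are summed separately. *)
Definition inner (u v : cseq) : C :=
  (Series (fun k => Re (u k * Cconj (v k))%C),
   Series (fun k => Im (u k * Cconj (v k))%C)).

Definition delta (n : nat) : cseq :=
  fun k => if Nat.eqb k n then RtoC 1 else RtoC 0.

(** * Operators and semigroups in l^2 *)

(** An unbounded operator: [act] is relevant only on [dom], which is meant to
    consist of elements of [ell2]. *)
Record operator : Type := Operator { dom : cseq -> Prop; act : cseq -> cseq }.

Definition bounded_linear (B : cseq -> cseq) : Prop :=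
  (forall u, ell2 u -> ell2 (B u)) /\
  (forall (a b : C) u v, ell2 u -> ell2 v -> forall n,
     B (fun k => a * u k + b * v k)%C n = (a * B u n + b * B v n)%C) /\
  (exists M : R, forall u, ell2 u -> norm2 (B u) <= M * norm2 u).

Definition C0_semigroup (T : R -> cseq -> cseq) : Prop :=
  (forall t, 0 <= t -> bounded_linear (T t)) /\
  (forall u, ell2 u -> forall n, T 0 u n = u n) /\
  (forall s t, 0 <= s -> 0 <= t -> forall u, ell2 u -> forall n,
     T (s + t) u n = T s (T t u) n) /\
  (forall u, ell2 u ->
     filterlim (fun h => norm2 (fun k => T h u k - u k)%C)
       (at_right 0) (locally 0)).

(** The graph of the infinitesimal generator: [u] is in its domain with image
    [v] when (T(h)u - u)/h tends to [v] in norm as h -> 0+. *)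
Definition generator (T : R -> cseq -> cseq) (u v : cseq) : Prop :=
  ell2 u /\ ell2 v /\
  filterlim (fun h => norm2 (fun k => (T h u k - u k) / RtoC h - v k)%C)
    (at_right 0) (locally 0).

(** [T t] is e^{-tA}: [T] is the strongly continuous semigroup whose generator
    is exactly -A, domain included. Such a [T] is unique on [ell2]; for
    self-adjoint nonnegative A it exists and agrees with the functional
    calculus. *)
Definition exp_semigroup (A : operator) (T : R -> cseq -> cseq) : Prop :=
  C0_semigroup T /\
  forall u v, generator T u v <->
    (dom A u /\ forall n, v n = (- act A u n)%C).

Definition kernel (B : cseq -> cseq) (n m : nat) : C :=
  inner (B (delta n)) (delta m).

(** * The discrete Laguerre operator *)

Definition tau (alpha : R) (u : cseq) : cseq := fun n =>
  (- (RtoC (sqrt (INR n * (INR n + alpha))) *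
        match n with O => RtoC 0 | S p => u p end)
   + RtoC (2 * INR n + 1 + alpha) * u n
   - RtoC (sqrt ((INR n + 1) * (INR n + 1 + alpha))) * u (S n))%C.

Definition laguerre_operator (alpha : R) : operator :=
  Operator (fun u => ell2 u /\ ell2 (tau alpha u)) (tau alpha).

(** * Jacobi polynomials and the closed form of the kernel *)

Fixpoint poch (x : R) (n : nat) : R :=
  match n with O => 1 | S k => poch x k * (x + INR k) end.

Definition sigma (alpha : R) (n : nat) : R :=
  sqrt (poch (alpha + 1) n / INR (fact n)).

Definition jacobi (n : nat) (a b x : R) : R :=
  poch (a + 1) n / INR (fact n) *
  sum_f_R0 (fun k =>
    poch (- INR n) k * poch (INR n + a + b + 1) k /
      (poch (a + 1) k * INR (fact k)) * ((1 - x) / 2) ^ k) n.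

Definition kernel_formula (alpha : R) (n m : nat) (t : R) : R :=
  1 / Rpower (1 + t) (1 + alpha) * ((t - 1) / (t + 1)) ^ n *
  powerRZ (t / (t + 1)) (Z.of_nat m - Z.of_nat n) *
  (sigma alpha m / sigma alpha n) *
  jacobi n alpha (INR m - INR n) ((t ^ 2 + 1) / (t ^ 2 - 1)).

(** [r] is the value at [t] of the function [f], whose expression is singular
    only at [t = 1] and is extended there by continuity (the two-sided limit is
    required to exist). *)
Definition value_extended_at_1 (f : R -> R) (t r : R) : Prop :=
  (t <> 1 -> r = f t) /\ (t = 1 -> is_lim f 1 r).

(* Main.v *)
Require Import Defs.
From Stdlib Require Import Reals ZArith Lra Lia FunctionalExtensionality ClassicalEpsilon.
From Coquelicot Require Import Coquelicot.
(* [Reals] has a [sigma] of its own; the weight is the one meant below. *)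
Import Defs.
Open Scope R_scope.

(** The heat semigroup of the discrete Laguerre operator H maps coherent vectors
    to coherent vectors. Put c = alpha + 1 and g_z = (sigma_n z^n)_n for real z
    with |z| < 1. Since sqrt(n (n + alpha)) sigma_(n-1) = n sigma_n,
<<
      - H g_z = (1 - z)^2 d/dz g_z - c (1 - z) g_z ,
>>
    a first-order operator in z, whose characteristics are straight in the
    coordinate w = 1 / (1 - z). Therefore
<<
      e^(-tH) g_z = (w / (w + t))^c g_(z(t)),   z(t) = 1 - 1 / (w + t).
>>
    This is proved in weak form ([pairing_conserved]): the pairing of
    T(s) delta_n with e^(-(t-s)H) g_z, the latter given by the formula, does not
    depend on s. Differentiating in s requires the action of H on generating
    functions ([gen_tau]) and the right derivative of s |-> T(s) delta_n, which
    the generator provides because delta_n and all its images T(s) delta_n lie in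
    the domain of H. A function with zero right derivative is constant only if it
    is also left continuous; [orbit_left_continuous] supplies this without a
    uniform bound on the operators.

    Comparing s = 0 with s = t gives the generating function
<<
      sum_m sigma_m (T(t) delta_n)(m) z^m = sigma_n (w / (w + t))^c z(t)^n .
>>
    Up to a constant and a rescaling of z this is the generating function of the
    Meixner polynomials ([meixner_generating_function]), so uniqueness of power
    series coefficients yields
<<
      e^(-tH)(n, m) = sigma_n sigma_m (1 + t)^(-c) (t / (1 + t))^(n + m)
                        2F1(-n, -m; c; 1 / t^2) ,
>>
    which is real, symmetric in n and m, and continuous at t = 1. Pfaff's
    transformation ([hyp_pfaff]) rewrites it as the Jacobi form for t <> 1. *)

(** * Terminating hypergeometric sums *)

Lemma poch_pos x k : 0 < x -> 0 < poch x k.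
Proof.
intros Hx; induction k as [|k IH]; simpl; [lra|].
apply Rmult_lt_0_compat; [exact IH|]. generalize (pos_INR k); lra.
Qed.

Lemma poch_Sl x k : poch x (S k) = x * poch (x + 1) k.
Proof.
induction k as [|k IH]; [simpl; ring|].
change (poch x (S (S k))) with (poch x (S k) * (x + INR (S k))).
rewrite IH, S_INR; simpl; ring.
Qed.

Lemma poch_neg_eq0 n k : (n < k)%nat -> poch (- INR n) k = 0.
Proof.
intros H; induction H as [|k H IH]; simpl; [ring|rewrite IH; ring].
Qed.

(** The terminating Gauss series 2F1(-n, b; c; y). Every special-function
    identity below comes from one recurrence in [n], [hyp_pascal]. *)
Definition hyp_term (n : nat) (b c y : R) (k : nat) : R :=
  poch (- INR n) k * poch b k / (poch c k * INR (fact k)) * y ^ k.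

Definition hyp (n : nat) (b c y : R) : R := sum_f_R0 (hyp_term n b c y) n.

Lemma hyp_0 b c y : hyp 0 b c y = 1.
Proof. unfold hyp, hyp_term; simpl; field. Qed.

Lemma hyp_extend n N b c y :
  (n <= N)%nat -> hyp n b c y = sum_f_R0 (hyp_term n b c y) N.
Proof.
intros H; induction H as [|N H IH]; [reflexivity|].
rewrite IH; simpl; unfold hyp_term.
rewrite (poch_neg_eq0 n (S N)) by lia.
unfold Rdiv; ring.
Qed.

(** Pascal's rule for (-n)_k / k!, up to sign a binomial coefficient: going
    from [n] to [n + 1] adds the previous term, which carries the shifted
    parameters b + 1 and c + 1. *)
Lemma hyp_pascal n b c y : 0 < c ->
  hyp (S n) b c y = hyp n b c y - y * (b / c) * hyp n (b + 1) (c + 1) y.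
Proof.
intros Hc.
rewrite (hyp_extend n (S n) b c y) by lia; unfold hyp.
rewrite 2!(decomp_sum _ (S n)) by lia; simpl Init.Nat.pred.
rewrite scal_sum.
match goal with |- ?x + ?s = ?y + ?s' - ?s'' =>
  replace x with y by (unfold hyp_term; simpl; field);
  cut (s = s' - s''); [intros ->; ring|] end.
rewrite <- minus_sum.
apply sum_eq; intros k _.
unfold hyp_term; rewrite !(poch_Sl b), !(poch_Sl c), (poch_Sl (- INR (S n))).
replace (- INR (S n) + 1) with (- INR n) by (rewrite S_INR; ring).
change (poch (- INR n) (S k)) with (poch (- INR n) k * (- INR n + INR k)).
change (fact (S k)) with (S k * fact k)%nat.
rewrite mult_INR, !S_INR; simpl pow.
assert (H := poch_pos (c + 1) k ltac:(lra)).
assert (H' := INR_fact_lt_0 k). assert (H'' := pos_INR k).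
field; repeat split; lra.
Qed.

(** Termwise this is (c - a) + (a + k) = c + k. It reconciles the two ways in
    which Pascal's rule acts on the two sides of Pfaff's transformation. *)
Lemma hyp_contiguous n a c y : 0 < c ->
  c * hyp n a c y = (c - a) * hyp n a (c + 1) y + a * hyp n (a + 1) (c + 1) y.
Proof.
intros Hc; unfold hyp; rewrite !scal_sum, <- plus_sum.
apply sum_eq; intros k _; unfold hyp_term.
assert (E : forall x, poch (x + 1) k * x = poch x k * (x + INR k)).
{ intros x; rewrite Rmult_comm, <- poch_Sl; reflexivity. }
assert (Ha := E a).
assert (Hp := poch_pos (c + 1) k ltac:(lra)).
assert (Hk := pos_INR k).
replace (poch c k) with (poch (c + 1) k * c / (c + INR k))
  by (rewrite E; field; lra).
transitivity (poch (- INR n) k / (poch (c + 1) k * INR (fact k)) * y ^ k *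
  (poch a k * (c + INR k))).
{ field; assert (H' := INR_fact_lt_0 k); repeat split; lra. }
transitivity (poch (- INR n) k / (poch (c + 1) k * INR (fact k)) * y ^ k *
  (poch a k * (c - a) + poch (a + 1) k * a)).
{ rewrite Ha; ring. }
field; assert (H' := INR_fact_lt_0 k); repeat split; lra.
Qed.

(** Pfaff's transformation. It turns the Jacobi polynomial of the kernel formula
    into a sum symmetric in [n] and [m] and regular at t = 1. *)
Lemma hyp_pfaff n b c x : 0 < c -> x <> 1 ->
  (1 - x) ^ n * hyp n b c (x / (x - 1)) = hyp n (c - b) c x.
Proof.
intros Hc Hx; revert b c Hc; induction n as [|n IH]; intros b c Hc.
{ rewrite !hyp_0; simpl; ring. }
rewrite !hyp_pascal by exact Hc.
simpl pow.
transitivity ((1 - x) * ((1 - x) ^ n * hyp n b c (x / (x - 1))) +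
  x * (b / c) * ((1 - x) ^ n * hyp n (b + 1) (c + 1) (x / (x - 1)))).
{ field; split; lra. }
rewrite !IH by lra.
replace (c + 1 - (b + 1)) with (c - b) by ring.
assert (H := hyp_contiguous n (c - b) c x Hc).
replace (c - (c - b)) with b in H by ring.
replace (b / c * hyp n (c - b) (c + 1) x) with
  (hyp n (c - b) c x - (c - b) / c * hyp n (c - b + 1) (c + 1) x).
2:{ apply Rmult_eq_reg_l with c; [|lra].
    rewrite Rmult_minus_distr_l, H; field; lra. }
replace (x * (b / c) * hyp n (c - b) (c + 1) x) with
  (x * (b / c * hyp n (c - b) (c + 1) x)) by ring.
replace (b / c * hyp n (c - b) (c + 1) x) with
  (hyp n (c - b) c x - (c - b) / c * hyp n (c - b + 1) (c + 1) x).
2:{ apply Rmult_eq_reg_l with c; [|lra].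
    rewrite Rmult_minus_distr_l, H; field; lra. }
ring.
Qed.

(** Both sums may run to [n + m], the extra terms being 0. *)
Lemma hyp_sym n m c x : hyp n (- INR m) c x = hyp m (- INR n) c x.
Proof.
rewrite (hyp_extend n (n + m)) by lia.
rewrite (hyp_extend m (n + m)) by lia.
apply sum_eq; intros k _; unfold hyp_term.
now rewrite (Rmult_comm (poch (- INR n) k)).
Qed.

Lemma continuous_hyp n b c y : continuous (hyp n b c) y.
Proof.
unfold hyp.
apply (ex_derive_continuous (fun x => sum_f_R0 (hyp_term n b c x) n)).
generalize n at 2; intros N; induction N as [|N IH]; simpl.
- unfold hyp_term; auto_derive; trivial.
- apply @ex_derive_plus; [exact IH|]. unfold hyp_term; auto_derive; trivial.
Qed.

(** * Power series on the unit disk *)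

Lemma disk_inside a x : Rbar_le 1 (CV_radius a) -> Rabs x < 1 ->
  Rbar_lt (Rabs x) (CV_radius a).
Proof. intros Ha Hx; apply Rbar_lt_le_trans with (2 := Ha); exact Hx. Qed.

(** The radius is the supremum of the r for which (a_m r^m)_m is bounded, so no
    such r exceeds it. *)
Lemma radius_ge_1 a :
  (forall r, 0 < r < 1 -> exists M, forall m, Rabs (a m) * r ^ m <= M) ->
  Rbar_le 1 (CV_radius a).
Proof.
intros H; apply Rbar_not_lt_le; intros Hlt.
destruct (CV_radius_bounded a) as [Hub _].
(* A point of (0, 1) beyond a radius supposed to be smaller than 1; any point
   will do if that radius is -oo. *)
set (r := match CV_radius a with Finite x => (Rmax x 0 + 1) / 2 | _ => /2 end).
assert (Hr : 0 < r < 1 /\ Rbar_lt (CV_radius a) r).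
{ unfold r; destruct (CV_radius a) as [x| |]; simpl in *;
    [unfold Rmax; destruct Rle_dec; lra|tauto|split; [lra|exact I]]. }
destruct Hr as [Hr1 Hr2]; destruct (H r Hr1) as [M HM].
apply (Rbar_lt_not_le _ _ Hr2); apply Hub; exists M; intros m.
rewrite Rabs_mult, (Rabs_right (r ^ m)); [apply HM|].
apply Rle_ge, pow_le; lra.
Qed.

Lemma is_lim_seq_ratio c : is_lim_seq (fun n => (c + INR n) / (INR n + 1)) 1.
Proof.
apply is_lim_seq_ext with (fun n => 1 + (c - 1) * / (INR (S n))).
{ intros n; rewrite S_INR; assert (H := pos_INR n); field; lra. }
replace (Finite 1) with (Finite (1 + (c - 1) * 0)) by (f_equal; ring).
apply is_lim_seq_plus'; [apply is_lim_seq_const|].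
apply (is_lim_seq_scal_l _ (c - 1) 0).
apply (is_lim_seq_incr_1 (fun n => / INR n)).
replace (Finite 0) with (Rbar_inv p_infty) by reflexivity.
apply is_lim_seq_inv; [apply is_lim_seq_INR|discriminate].
Qed.

(** * The binomial series and the Meixner generating function *)

(** Taylor coefficients of (1 - x)^(-c), and also, for c = alpha + 1, the squares
    of [sigma alpha]. *)
Definition binom_coef (c : R) (m : nat) : R := poch c m / INR (fact m).

Lemma binom_coef_pos c m : 0 < c -> 0 < binom_coef c m.
Proof.
intros Hc; apply Rdiv_lt_0_compat; [now apply poch_pos|apply INR_fact_lt_0].
Qed.

Lemma binom_coef_S c m :
  (INR m + 1) * binom_coef c (S m) = (c + INR m) * binom_coef c m.
Proof.
unfold binom_coef; simpl poch.
change (fact (S m)) with (S m * fact m)%nat; rewrite mult_INR, S_INR.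
assert (H := pos_INR m); assert (H' := INR_fact_lt_0 m); field; lra.
Qed.

Lemma binom_coef_ratio c m : 0 < c ->
  binom_coef c (S m) / binom_coef c m = (c + INR m) / (INR m + 1).
Proof.
intros Hc; assert (H := binom_coef_pos c m Hc).
assert (H' := pos_INR m).
apply Rmult_eq_reg_l with ((INR m + 1) * binom_coef c m).
2:{ apply Rmult_integral_contrapositive; lra. }
transitivity ((INR m + 1) * binom_coef c (S m)); [field; lra|].
rewrite binom_coef_S; field; lra.
Qed.

Lemma radius_ratio_1 a : (forall n, 0 < a n) ->
  is_lim_seq (fun n => a (S n) / a n) 1 -> Rbar_le 1 (CV_radius a).
Proof.
intros Ha Hl; rewrite (CV_radius_finite_DAlembert a 1).
- simpl; lra.
- intros n; specialize (Ha n); lra.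
- lra.
- apply is_lim_seq_ext with (2 := Hl); intros n.
  rewrite Rabs_right; [reflexivity|].
  apply Rle_ge, Rlt_le, Rdiv_lt_0_compat; apply Ha.
Qed.

Lemma radius_binom c : 0 < c -> Rbar_le 1 (CV_radius (binom_coef c)).
Proof.
intros Hc; apply radius_ratio_1; [intros n; now apply binom_coef_pos|].
apply is_lim_seq_ext with (2 := is_lim_seq_ratio c).
intros n; now rewrite binom_coef_ratio.
Qed.

Lemma binom_ode c x : 0 < c -> Rabs x < 1 ->
  (1 - x) * PSeries (PS_derive (binom_coef c)) x = c * PSeries (binom_coef c) x.
Proof.
intros Hc Hx.
assert (Hr := disk_inside _ x (radius_binom c Hc) Hx).
assert (H1 : ex_pseries (binom_coef c) x) by (apply CV_radius_inside; exact Hr).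
assert (H2 : ex_pseries (PS_derive (binom_coef c)) x).
{ apply CV_radius_inside; rewrite CV_radius_derive; exact Hr. }
assert (E : PSeries (PS_derive (binom_coef c)) x =
  c * PSeries (binom_coef c) x + x * PSeries (PS_derive (binom_coef c)) x).
{ rewrite <- PSeries_scal, <- PSeries_incr_1.
  rewrite <- PSeries_plus.
  - apply PSeries_ext; intros m.
    change (INR (S m) * binom_coef c (S m) = c * binom_coef c m +
      match m with O => 0 | S k => INR (S k) * binom_coef c (S k) end).
    rewrite S_INR, binom_coef_S.
    destruct m as [|m]; simpl; ring.
  - apply ex_pseries_scal; [apply Rmult_comm|exact H1].
  - apply ex_pseries_incr_1; exact H2. }
rewrite Rmult_minus_distr_r, Rmult_1_l, E at 1; ring.
Qed.

(** By the differential equation [binom_ode], the product of the sum with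
    (1 - x)^c has zero derivative on the unit interval. *)
Lemma binomial_series c x : 0 < c -> Rabs x < 1 ->
  is_pseries (binom_coef c) x (Rpower (1 - x) (- c)).
Proof.
intros Hc Hx.
assert (Hconst : forall a b, -1 < a -> b < 1 -> a < b ->
  PSeries (binom_coef c) a * Rpower (1 - a) c =
  PSeries (binom_coef c) b * Rpower (1 - b) c).
{ intros a b Ha Hb Hab.
  apply (eq_is_derive (fun y => PSeries (binom_coef c) y * Rpower (1 - y) c)).
  2: exact Hab.
  intros y Hy.
  assert (Hy1 : Rabs y < 1) by (apply Rabs_def1; lra).
  evar_last.
  { apply (is_derive_mult (PSeries (binom_coef c)) (fun y => Rpower (1 - y) c)).
    - apply is_derive_PSeries, disk_inside; [now apply radius_binom|exact Hy1].
    - unfold Rpower; auto_derive; [lra|reflexivity].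
    - exact Rmult_comm. }
  unfold plus, mult, zero; simpl; fold (Rpower (1 - y) c).
  assert (E := binom_ode c y Hc Hy1).
  replace (PSeries (PS_derive (binom_coef c)) y) with
    (c * PSeries (binom_coef c) y / (1 - y)).
  - unfold Rpower, Rminus; field; lra.
  - rewrite <- E; field; lra. }
assert (E0 : PSeries (binom_coef c) 0 * Rpower (1 - 0) c = 1).
{ rewrite PSeries_0, Rminus_0_r; unfold binom_coef, Rpower; simpl.
  rewrite ln_1, Rmult_0_r, exp_0; field. }
assert (Ex : PSeries (binom_coef c) x * Rpower (1 - x) c = 1).
{ apply Rabs_def2 in Hx.
  destruct (Rtotal_order x 0) as [H|[H|H]].
  - rewrite (Hconst x 0); lra.
  - now rewrite H.
  - rewrite <- (Hconst 0 x); lra. }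
rewrite Rpower_Ropp.
replace (/ Rpower (1 - x) c) with (PSeries (binom_coef c) x).
- apply PSeries_correct, CV_radius_inside, disk_inside;
    [now apply radius_binom|exact Hx].
- apply Rmult_eq_reg_r with (Rpower (1 - x) c).
  + rewrite Ex; field; apply Rgt_not_eq, exp_pos.
  + apply Rgt_not_eq, exp_pos.
Qed.

(** As functions of [m], the sums [hyp n (- INR m) c x] are Meixner polynomials,
    and this is their generating function. By Pascal's rule, going from [n] to
    [n + 1] adds x X times the series for c + 1, that is, multiplies the sum by
    1 + x X / (1 - X). *)
Lemma meixner_generating_function n c x X : 0 < c -> Rabs X < 1 ->
  is_pseries (fun m => binom_coef c m * hyp n (- INR m) c x) X
    (Rpower (1 - X) (- c) * (1 + x * X / (1 - X)) ^ n).
Proof.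
intros Hc HX; revert c Hc; induction n as [|n IH]; intros c Hc.
{ simpl pow; rewrite Rmult_1_r.
  apply is_pseries_ext with (2 := binomial_series c X Hc HX).
  intros m; rewrite hyp_0; simpl; ring. }
assert (HX1 : X < 1) by (apply Rabs_def2 in HX; lra).
assert (H := is_pseries_plus _ _ _ _ _ (IH c Hc)
  (is_pseries_scal x _ _ _ (Rmult_comm _ _)
    (is_pseries_incr_1 _ _ _ (IH (c + 1) ltac:(lra))))).
evar_last.
{ apply is_pseries_ext with (2 := H); intros m.
  change (binom_coef c m * hyp n (- INR m) c x + x *
    match m with O => 0 | S k =>
      binom_coef (c + 1) k * hyp n (- INR k) (c + 1) x end =
    binom_coef c m * hyp (S n) (- INR m) c x).
  rewrite hyp_pascal by exact Hc.
  destruct m as [|m].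
  { simpl; field; lra. }
  replace (- INR (S m) + 1) with (- INR m) by (rewrite S_INR; ring).
  assert (Hm := pos_INR m).
  replace (binom_coef c (S m)) with (c / INR (S m) * binom_coef (c + 1) m).
  - rewrite S_INR; field; lra.
  - unfold binom_coef; rewrite poch_Sl.
    change (fact (S m)) with (S m * fact m)%nat; rewrite mult_INR, S_INR.
    assert (H' := INR_fact_lt_0 m); field; lra. }
unfold plus, scal; simpl; unfold mult; simpl.
replace (- (c + 1)) with (- c + - (1)) by ring.
rewrite Rpower_plus, (Rpower_Ropp _ 1), Rpower_1 by lra.
field; lra.
Qed.

(** * The weights sigma *)

Lemma sigma_pos alpha m : -1 < alpha -> 0 < sigma alpha m.
Proof. intros H; apply sqrt_lt_R0, (binom_coef_pos (alpha + 1)); lra. Qed.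

Lemma sigma_sqr alpha m : -1 < alpha ->
  sigma alpha m * sigma alpha m = binom_coef (alpha + 1) m.
Proof.
intros H; apply sqrt_sqrt, Rlt_le, (binom_coef_pos (alpha + 1)); lra.
Qed.

Lemma sigma_S alpha m : -1 < alpha ->
  sqrt (INR m + 1) * sigma alpha (S m) =
  sqrt (INR m + 1 + alpha) * sigma alpha m.
Proof.
intros H; assert (Hm := pos_INR m).
unfold sigma; fold (binom_coef (alpha + 1) (S m)) (binom_coef (alpha + 1) m).
rewrite <- !sqrt_mult; try lra;
  try (apply Rlt_le, binom_coef_pos; lra).
f_equal; rewrite binom_coef_S; ring.
Qed.

Lemma sigma_up alpha m : -1 < alpha ->
  sigma alpha m * sqrt ((INR m + 1) * (INR m + 1 + alpha)) =
  (INR m + 1) * sigma alpha (S m).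
Proof.
intros H; assert (Hm := pos_INR m).
rewrite sqrt_mult by lra.
rewrite <- (sqrt_sqrt (INR m + 1)) at 3 by lra.
rewrite Rmult_assoc, sigma_S by exact H; ring.
Qed.

Lemma sigma_down alpha m : -1 < alpha ->
  sigma alpha (S m) * sqrt ((INR m + 1) * (INR m + 1 + alpha)) =
  (INR m + 1 + alpha) * sigma alpha m.
Proof.
intros H; assert (Hm := pos_INR m).
rewrite sqrt_mult by lra.
rewrite <- (sqrt_sqrt (INR m + 1 + alpha)) at 2 by lra.
rewrite Rmult_assoc, <- sigma_S by exact H; ring.
Qed.

(** The ratio sigma_(n+1) / sigma_n tends to 1. So the coherent vectors
    (sigma_n z^n)_n are summable for |z| < 1. *)
Lemma radius_sigma alpha : -1 < alpha -> Rbar_le 1 (CV_radius (sigma alpha)).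
Proof.
intros H; apply radius_ratio_1; [intros n; now apply sigma_pos|].
apply is_lim_seq_ext with (fun n => sqrt ((alpha + 1 + INR n) / (INR n + 1))).
{ intros n; unfold sigma.
  fold (binom_coef (alpha + 1) (S n)) (binom_coef (alpha + 1) n).
  rewrite <- sqrt_div; [|apply Rlt_le|]; try (apply binom_coef_pos; lra).
  rewrite binom_coef_ratio by lra; reflexivity. }
replace (Finite 1) with (Finite (sqrt 1)) by now rewrite sqrt_1.
apply (is_lim_seq_continuous sqrt (fun n => (alpha + 1 + INR n) / (INR n + 1)));
  [apply continuity_pt_sqrt; lra|].
apply is_lim_seq_ratio.
Qed.

(** * Pairing with coherent vectors *)

(** The instances are [Re] and [Im]. Through such a form a complex sequence gives
    a real power series, and both parts of the kernel are found by one argument. *)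
Record real_form (p : C -> R) : Prop := {
  form_plus : forall a b, p (a + b)%C = p a + p b;
  form_scal : forall r a, p (RtoC r * a)%C = r * p a;
  form_bound : forall a, Rabs (p a) <= Cmod a }.

Lemma form_opp p a : real_form p -> p (- a)%C = - p a.
Proof.
intros Hp; replace (- a)%C with (RtoC (-1) * a)%C.
- rewrite (form_scal p Hp); ring.
- apply injective_projections; simpl; ring.
Qed.

Lemma real_form_Re : real_form Re.
Proof.
split.
- reflexivity.
- intros r [x y]; simpl; ring.
- intros a.
  rewrite <- (sqrt_Rsqr_abs (Re a)); unfold Cmod; apply sqrt_le_1_alt.
  unfold Rsqr, Re; assert (H := pow2_ge_0 (snd a)); nra.
Qed.

Lemma real_form_Im : real_form Im.
Proof.
split.
- reflexivity.
- intros r [x y]; simpl; ring.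
- intros a.
  rewrite <- (sqrt_Rsqr_abs (Im a)); unfold Cmod; apply sqrt_le_1_alt.
  unfold Rsqr, Im; assert (H := pow2_ge_0 (fst a)); nra.
Qed.

Lemma norm2_ge0 u : 0 <= norm2 u.
Proof. apply sqrt_pos. Qed.

Lemma Series_single (a : nat -> R) m : (forall k, k <> m -> a k = 0) ->
  is_series a (a m).
Proof.
intros H.
assert (E : forall N, sum_n a (m + N) = a m).
{ assert (E0 : forall k, (k < m)%nat -> sum_n a k = 0).
  { intros k; induction k as [|k IH]; intros Hk.
    - rewrite sum_O; apply H; lia.
    - rewrite sum_Sn, IH, H by lia; apply Rplus_0_r. }
  intros N; induction N as [|N IH].
  - rewrite Nat.add_0_r; destruct m as [|m]; [apply sum_O|].
    rewrite sum_Sn, E0 by lia; apply Rplus_0_l.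
  - rewrite Nat.add_succ_r, sum_Sn, IH, (H (S (m + N))) by lia.
    apply Rplus_0_r. }
change (is_lim_seq (sum_n a) (a m)).
apply (is_lim_seq_incr_n (sum_n a) m).
apply is_lim_seq_ext with (fun _ => a m); [|apply is_lim_seq_const].
intros N; rewrite Nat.add_comm; now rewrite E.
Qed.

Lemma coord_le_norm2 u m : ell2 u -> Cmod (u m) <= norm2 u.
Proof.
intros Hu; unfold norm2.
rewrite <- (sqrt_pow2 (Cmod (u m))) by apply Cmod_ge_0.
apply sqrt_le_1_alt.
set (e := fun k => if Nat.eqb k m then Cmod (u m) ^ 2 else 0).
replace (Cmod (u m) ^ 2) with (Series e).
- apply Series_le; [|exact Hu].
  intros k; unfold e; destruct (Nat.eqb_spec k m) as [->|_].
  + split; [apply pow2_ge_0|apply Rle_refl].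
  + split; [apply Rle_refl|apply pow2_ge_0].
- transitivity (e m); [|unfold e; now rewrite Nat.eqb_refl].
  apply is_series_unique, Series_single; intros k Hk; unfold e.
  now rewrite (proj2 (Nat.eqb_neq k m) Hk).
Qed.

(** [gen] below pairs a vector with the coherent vector (sigma_m z^m)_m; as a
    function of [z] it is a power series that determines the vector. *)
Definition gen_coef (alpha : R) (p : C -> R) (v : cseq) (m : nat) : R :=
  sigma alpha m * p (v m).

Lemma sigma_series alpha r : -1 < alpha -> 0 <= r < 1 ->
  ex_series (fun m => sigma alpha m * r ^ m).
Proof.
intros Ha Hr; apply ex_pseries_R, CV_radius_inside, disk_inside.
- now apply radius_sigma.
- rewrite Rabs_right; lra.
Qed.

Lemma gen_coef_bound alpha p v m : -1 < alpha -> real_form p -> ell2 v ->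
  Rabs (gen_coef alpha p v m) <= norm2 v * sigma alpha m.
Proof.
intros Ha Hp Hv; unfold gen_coef; rewrite Rabs_mult, Rabs_right.
- rewrite Rmult_comm; apply Rmult_le_compat_r; [now apply Rlt_le, sigma_pos|].
  apply Rle_trans with (1 := form_bound p Hp _); now apply coord_le_norm2.
- now apply Rgt_ge, sigma_pos.
Qed.

Lemma gen_coef_abs_series alpha p v z r : -1 < alpha -> real_form p ->
  ell2 v -> Rabs z <= r < 1 ->
  ex_series (fun m => Rabs (gen_coef alpha p v m * z ^ m)) /\
  Series (fun m => Rabs (gen_coef alpha p v m * z ^ m)) <=
    norm2 v * Series (fun m => sigma alpha m * r ^ m).
Proof.
intros Ha Hp Hv Hz.
assert (Hr : 0 <= r < 1) by (assert (H := Rabs_pos z); lra).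
assert (Hs := sigma_series alpha r Ha Hr).
assert (Hb : forall m, 0 <= Rabs (gen_coef alpha p v m * z ^ m) <=
  norm2 v * (sigma alpha m * r ^ m)).
{ intros m; split; [apply Rabs_pos|].
  rewrite Rabs_mult, <- Rmult_assoc, <- RPow_abs.
  apply Rmult_le_compat; [apply Rabs_pos|apply pow_le, Rabs_pos| |].
  - now apply gen_coef_bound.
  - apply pow_incr; split; [apply Rabs_pos|apply Hz]. }
assert (Hs' : ex_series (fun m => norm2 v * (sigma alpha m * r ^ m)))
  by now apply (ex_series_scal_l (V := R_NormedModule) (norm2 v)) in Hs.
split.
- apply (ex_series_le (V := R_CompleteNormedModule)) with (2 := Hs').
  intros m; unfold norm; simpl; unfold abs; simpl; rewrite Rabs_Rabsolu; apply Hb.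
- rewrite <- Series_scal_l; apply Series_le; [exact Hb|exact Hs'].
Qed.

Lemma radius_gen_coef alpha p v : -1 < alpha -> real_form p -> ell2 v ->
  Rbar_le 1 (CV_radius (gen_coef alpha p v)).
Proof.
intros Ha Hp Hv; apply radius_ge_1; intros r Hr.
assert (Hs := sigma_series alpha r Ha ltac:(lra)).
apply ex_series_lim_0 in Hs.
destruct (maj_by_pos (fun m => sigma alpha m * r ^ m)) as [M [HM0 HM]].
{ exists 0; apply is_lim_seq_Reals; exact Hs. }
exists (norm2 v * M); intros m.
apply Rle_trans with (norm2 v * (sigma alpha m * r ^ m)).
- rewrite <- Rmult_assoc; apply Rmult_le_compat_r; [apply pow_le; lra|].
  now apply gen_coef_bound.
- apply Rmult_le_compat_l; [apply norm2_ge0|].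
  apply Rle_trans with (2 := HM m), Rle_abs.
Qed.

Definition gen (alpha : R) (p : C -> R) (v : cseq) (z : R) : R :=
  PSeries (gen_coef alpha p v) z.

Lemma gen_bound alpha p v z r : -1 < alpha -> real_form p ->
  ell2 v -> Rabs z <= r < 1 ->
  Rabs (gen alpha p v z) <= norm2 v * Series (fun m => sigma alpha m * r ^ m).
Proof.
intros Ha Hp Hv Hz.
destruct (gen_coef_abs_series alpha p v z r Ha Hp Hv Hz) as [H1 H2].
apply Rle_trans with (2 := H2); unfold gen, PSeries; now apply Series_Rabs.
Qed.

(** On generating functions -H acts as the first-order operator
    (1 - z)^2 d/dz - (alpha + 1)(1 - z). The square roots in [tau] disappear
    against [sigma], because sqrt(n (n + alpha)) sigma_(n-1) = n sigma_n. *)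
Lemma gen_tau alpha p v z : -1 < alpha -> real_form p -> ell2 v -> Rabs z < 1 ->
  gen alpha p (fun k => - tau alpha v k)%C z =
  (1 - z) ^ 2 * PSeries (PS_derive (gen_coef alpha p v)) z -
  (alpha + 1) * (1 - z) * gen alpha p v z.
Proof.
intros Ha Hp Hv Hz.
set (a := gen_coef alpha p v).
assert (Hr := disk_inside a z (radius_gen_coef _ _ _ Ha Hp Hv) Hz).
assert (H1 := PSeries_correct _ _ (CV_radius_inside _ _ Hr)).
rewrite <- CV_radius_derive in Hr.
assert (H2 := PSeries_correct _ _ (CV_radius_inside _ _ Hr)).
set (D := PS_derive a) in *.
assert (H3 := is_pseries_incr_1 _ _ _ H2).
assert (H4 := is_pseries_incr_1 _ _ _ H3).
assert (H5 := is_pseries_incr_1 _ _ _ H1).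
assert (Hc := Rmult_comm : forall x y : R_AbsRing, mult x y = mult y x).
assert (H := is_pseries_plus _ _ _ _ _
  (is_pseries_plus _ _ _ _ _ (is_pseries_plus _ _ _ _ _ H2 H4)
    (is_pseries_scal (-2) _ _ _ (Hc _ _) H3))
  (is_pseries_plus _ _ _ _ _
    (is_pseries_scal (- (alpha + 1)) _ _ _ (Hc _ _) H1)
    (is_pseries_scal (alpha + 1) _ _ _ (Hc _ _) H5))).
unfold gen; transitivity
  ((PSeries D z + z * (z * PSeries D z) + -2 * (z * PSeries D z)) +
   (- (alpha + 1) * PSeries a z + (alpha + 1) * (z * PSeries a z))).
2:{ fold a; ring. }
apply is_pseries_unique.
apply is_pseries_ext with (2 := H); intros m.
change (D m + PS_incr_1 (PS_incr_1 D) m + -2 * PS_incr_1 D m +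
  (- (alpha + 1) * a m + (alpha + 1) * PS_incr_1 a m) =
  gen_coef alpha p (fun k => - tau alpha v k)%C m).
unfold gen_coef at 1, tau.
rewrite (form_opp p _ Hp); unfold Cminus.
rewrite !(form_plus p Hp), !(form_opp p _ Hp), !(form_scal p Hp).
assert (Eu := sigma_up alpha m Ha).
assert (ED : forall k, D k = (INR k + 1) * (sigma alpha (S k) * p (v (S k)))).
{ intros k; unfold D, PS_derive; rewrite S_INR; reflexivity. }
destruct m as [|m].
- change (PS_incr_1 (PS_incr_1 D) 0%nat) with 0.
  change (PS_incr_1 D 0%nat) with 0; change (PS_incr_1 a 0%nat) with 0.
  rewrite ED; unfold a, gen_coef.
  assert (E0 : p 0%C = 0).
  { replace (RtoC 0) with (RtoC 0 * 0)%C by ring.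
    rewrite (form_scal p Hp); ring. }
  rewrite E0.
  replace ((INR 0 + 1) * (sigma alpha 1 * p (v 1%nat))) with
    ((INR 0 + 1) * sigma alpha 1 * p (v 1%nat)) by ring.
  rewrite <- Eu; simpl INR. ring.
- change (PS_incr_1 (PS_incr_1 D) (S m)) with (PS_incr_1 D m).
  change (PS_incr_1 D (S m)) with (D m); change (PS_incr_1 a (S m)) with (a m).
  replace (PS_incr_1 D m) with (INR m * a m).
  2:{ destruct m as [|m]; [simpl; unfold zero; simpl; ring|].
      simpl PS_incr_1; rewrite ED, S_INR; reflexivity. }
  rewrite !ED; unfold a, gen_coef.
  assert (Ed := sigma_down alpha m Ha).
  replace ((INR (S m) + 1) * (sigma alpha (S (S m)) * p (v (S (S m))))) with
    ((INR (S m) + 1) * sigma alpha (S (S m)) * p (v (S (S m)))) by ring.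
  rewrite <- Eu.
  rewrite !(S_INR m) in *.
  transitivity (sigma alpha (S m) * sqrt ((INR m + 1) * (INR m + 1 + alpha)) *
    p (v m) - sigma alpha (S m) * ((2 * (INR m + 1) + 1 + alpha) * p (v (S m))) +
    sigma alpha (S m) * sqrt ((INR m + 1 + 1) * (INR m + 1 + 1 + alpha)) *
    p (v (S (S m)))).
  + rewrite Ed; ring.
  + ring.
Qed.

(** * Geometry of l^2 *)

Lemma right_limit_0 (f : R -> R) : (forall h, 0 <= f h) ->
  filterlim f (at_right 0) (locally 0) <->
  (forall eps, 0 < eps -> exists d, 0 < d /\ forall h, 0 < h < d -> f h < eps).
Proof.
intros Hf; split.
- intros H eps Heps.
  destruct (proj1 (filterlim_locally f 0) H (mkposreal eps Heps)) as [d Hd].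
  exists d; split; [apply cond_pos|]; intros h Hh.
  assert (Hb : ball 0 d h).
  { change (Rabs (h - 0) < d); rewrite Rminus_0_r, Rabs_right; lra. }
  specialize (Hd h Hb (proj1 Hh)).
  change (Rabs (f h - 0) < eps) in Hd.
  apply Rle_lt_trans with (2 := Hd); rewrite Rminus_0_r; apply Rle_abs.
- intros H; apply filterlim_locally; intros eps.
  destruct (H eps (cond_pos eps)) as [d [Hd0 Hd]].
  exists (mkposreal d Hd0); intros h Hb Hh.
  change (Rabs (h - 0) < d) in Hb; rewrite Rminus_0_r, Rabs_right in Hb by lra.
  change (Rabs (f h - 0) < eps).
  rewrite Rminus_0_r, Rabs_right by (apply Rle_ge, Hf).
  apply Hd; lra.
Qed.

Lemma Cmod_plus_sqr (x y : C) :
  Cmod (x + y)%C ^ 2 <= 2 * Cmod x ^ 2 + 2 * Cmod y ^ 2.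
Proof.
assert (H := Cmod_triangle x y).
assert (H0 := Cmod_ge_0 (x + y)%C).
apply Rle_trans with ((Cmod x + Cmod y) ^ 2); [apply pow_incr; lra|].
assert (H1 := pow2_ge_0 (Cmod x - Cmod y)); nra.
Qed.

Lemma ell2_scal (a : C) u : ell2 u -> ell2 (fun k => a * u k)%C.
Proof.
intros Hu; apply ex_series_ext with (fun k => Cmod a ^ 2 * Cmod (u k) ^ 2).
{ intros k; rewrite Cmod_mult, Rpow_mult_distr; reflexivity. }
now apply (ex_series_scal_l (V := R_NormedModule)).
Qed.

Lemma sqr_sum_series u v : ell2 u -> ell2 v ->
  ex_series (fun k => 2 * Cmod (u k) ^ 2 + 2 * Cmod (v k) ^ 2).
Proof.
intros Hu Hv; apply (ex_series_plus (V := R_NormedModule));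
  now apply (ex_series_scal_l (V := R_NormedModule)).
Qed.

Lemma ell2_plus u v : ell2 u -> ell2 v -> ell2 (fun k => u k + v k)%C.
Proof.
intros Hu Hv.
apply (ex_series_le (V := R_CompleteNormedModule))
  with (2 := sqr_sum_series u v Hu Hv).
intros k; unfold norm; simpl; unfold abs; simpl.
rewrite Rabs_right by (apply Rle_ge, pow2_ge_0); apply Cmod_plus_sqr.
Qed.

Lemma ell2_minus u v : ell2 u -> ell2 v -> ell2 (fun k => u k - v k)%C.
Proof.
intros Hu Hv.
replace (fun k => u k - v k)%C with (fun k => u k + RtoC (-1) * v k)%C.
- now apply ell2_plus, ell2_scal.
- apply functional_extensionality; intros k.
  apply injective_projections; simpl; ring.
Qed.

Definition dist2 (u v : cseq) : R := norm2 (fun k => u k - v k)%C.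

Lemma dist2_sym u v : dist2 u v = dist2 v u.
Proof.
unfold dist2, norm2; f_equal; apply Series_ext; intros k; f_equal.
rewrite <- Cmod_opp; f_equal; apply injective_projections; simpl; ring.
Qed.

(** Weaker than the triangle inequality, but a termwise consequence of
    |x + y|^2 <= 2 |x|^2 + 2 |y|^2, and enough for limits. *)
Lemma dist2_quasi_triangle u v w : ell2 u -> ell2 v -> ell2 w ->
  dist2 u v <= 2 * (dist2 u w + dist2 w v).
Proof.
intros Hu Hv Hw.
assert (Huw := ell2_minus u w Hu Hw); assert (Hwv := ell2_minus w v Hw Hv).
assert (Ha := norm2_ge0 (fun k => u k - w k)%C).
assert (Hb := norm2_ge0 (fun k => w k - v k)%C).
unfold dist2; rewrite <- (sqrt_pow2 (2 * _)) by lra.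
unfold norm2 at 1; apply sqrt_le_1_alt.
apply Rle_trans with (2 * norm2 (fun k => u k - w k)%C ^ 2 +
  2 * norm2 (fun k => w k - v k)%C ^ 2); [|nra].
assert (E : forall x, ell2 x -> norm2 x ^ 2 = Series (fun k => Cmod (x k) ^ 2)).
{ intros x Hx; unfold norm2; apply pow2_sqrt.
  replace 0 with (Series (fun k => 0 * Cmod (x k) ^ 2)).
  - apply Series_le; [|exact Hx].
    intros k; assert (H := pow2_ge_0 (Cmod (x k))); lra.
  - rewrite Series_scal_l; ring. }
rewrite !E by assumption.
rewrite <- !Series_scal_l, <- Series_plus.
- apply Series_le; [|now apply (sqr_sum_series (fun k => u k - w k)%C)].
  intros k; split; [apply pow2_ge_0|].
  replace (u k - v k)%C with ((u k - w k) + (w k - v k))%C by ring.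
  apply Cmod_plus_sqr.
- now apply (ex_series_scal_l (V := R_NormedModule)).
- now apply (ex_series_scal_l (V := R_NormedModule)).
Qed.

Lemma bounded_linear_minus B u v : bounded_linear B -> ell2 u -> ell2 v ->
  B (fun k => u k - v k)%C = (fun n => B u n - B v n)%C.
Proof.
intros [_ [HB _]] Hu Hv; apply functional_extensionality; intros n.
assert (E : forall x y : C, (x - y = RtoC 1 * x + RtoC (-1) * y)%C).
{ intros x y; apply injective_projections; simpl; ring. }
rewrite E, <- (HB (RtoC 1) (RtoC (-1)) u v Hu Hv n).
f_equal; apply functional_extensionality; intros k; apply E.
Qed.

Lemma bounded_linear_scal B a u : bounded_linear B -> ell2 u ->
  B (fun k => a * u k)%C = (fun n => a * B u n)%C.
Proof.
intros [_ [HB _]] Hu; apply functional_extensionality; intros n.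
assert (E : forall x y : C, (a * x = a * x + RtoC 0 * y)%C) by (intros; ring).
rewrite (E _ (B u n)), <- (HB a (RtoC 0) u u Hu Hu n).
f_equal; apply functional_extensionality; intros k; apply E.
Qed.

Lemma bounded_linear_pos_bound B : bounded_linear B ->
  exists M, 0 < M /\ forall u, ell2 u -> norm2 (B u) <= M * norm2 u.
Proof.
intros [_ [_ [M HM]]]; exists (Rmax M 1); split.
- assert (H := Rmax_r M 1); lra.
- intros u Hu; apply Rle_trans with (1 := HM u Hu).
  apply Rmult_le_compat_r; [apply norm2_ge0|apply Rmax_l].
Qed.

(** * Orbits of a strongly continuous semigroup *)

Lemma semigroup_add T s t u : C0_semigroup T -> 0 <= s -> 0 <= t -> ell2 u ->
  T (s + t) u = T s (T t u).
Proof.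
intros HT Hs Ht Hu; apply functional_extensionality; intros n; now apply HT.
Qed.

Lemma semigroup_ell2 T s u : C0_semigroup T -> 0 <= s -> ell2 u -> ell2 (T s u).
Proof. intros HT Hs Hu; now apply HT. Qed.

Lemma orbit_right_continuous T u s eps : C0_semigroup T -> ell2 u -> 0 <= s ->
  0 < eps ->
  exists d, 0 < d /\ forall h, 0 < h < d -> dist2 (T (s + h) u) (T s u) < eps.
Proof.
intros HT Hu Hs Heps.
assert (Hv := semigroup_ell2 T s u HT Hs Hu).
assert (H := proj2 (proj2 (proj2 HT)) _ Hv).
assert (H' := proj1 (right_limit_0 _ (fun h => norm2_ge0 _)) H).
destruct (H' eps Heps) as [d [Hd0 Hd]].
exists d; split; [exact Hd0|]; intros h Hh.
rewrite Rplus_comm, semigroup_add by (try assumption; lra).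
now apply Hd.
Qed.

(** A right-continuous function has points of continuity in every interval.
    Right continuity at the midpoint of an interval gives a smaller interval,
    starting there, on which the oscillation is as small as desired; the point
    common to a nested sequence of these is a point of continuity. *)
Lemma continuity_point_of_right_continuous (D : R -> R -> R) s :
  (forall x y, D x y = D y x) ->
  (forall x y z, 0 < x -> 0 < y -> 0 < z -> D x y <= 2 * (D x z + D z y)) ->
  (forall x eps, 0 < x -> 0 < eps -> exists d, 0 < d /\
     forall h, 0 < h < d -> D (x + h) x < eps) ->
  0 < s ->
  exists x, 0 < x < s /\ forall eps, 0 < eps -> exists d, 0 < d /\
     forall y, Rabs (y - x) < d -> D y x < eps.
Proof.
intros Dsym Dtri Dright Hs.
set (ok := fun I : R * R => 0 < fst I < snd I).
assert (step : forall (n : nat) (I : sig ok), {J : sig ok |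
  fst (proj1_sig I) < fst (proj1_sig J) /\
  snd (proj1_sig J) < snd (proj1_sig I) /\
  forall x, fst (proj1_sig J) < x < snd (proj1_sig J) ->
    D x (fst (proj1_sig J)) < / INR (S n)}).
{ intros n [[a b] Hab]; simpl; apply constructive_indefinite_description.
  unfold ok in Hab; simpl in Hab.
  set (a' := (a + b) / 2).
  destruct (Dright a' (/ INR (S n))) as [d [Hd0 Hd]].
  { unfold a'; lra. }
  { apply Rinv_0_lt_compat, lt_0_INR; lia. }
  set (b' := Rmin (a' + d) ((a' + b) / 2)).
  assert (Hb' : a' < b' /\ b' <= a' + d /\ b' < b).
  { unfold b', Rmin; destruct Rle_dec; unfold a' in *; lra. }
  assert (HJ : ok (a', b')) by (unfold ok, a' in *; simpl; lra).
  exists (exist _ (a', b') HJ); simpl; repeat split.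
  - unfold a'; lra.
  - apply Hb'.
  - intros x Hx; replace x with (a' + (x - a')) by ring; apply Hd; lra. }
set (I := nat_rect (fun _ => sig ok) (exist ok (s / 2, s) ltac:(unfold ok; simpl; lra))
  (fun n J => proj1_sig (step n J))).
set (lo := fun n => fst (proj1_sig (I n))); set (hi := fun n => snd (proj1_sig (I n))).
assert (Hlohi : forall n, 0 < lo n < hi n) by (intros n; exact (proj2_sig (I n))).
assert (Hstep : forall n, lo n < lo (S n) /\ hi (S n) < hi n /\
  forall x, lo (S n) < x < hi (S n) -> D x (lo (S n)) < / INR (S n)).
{ intros n; exact (proj2_sig (step n (I n))). }
assert (Hlo : forall n k, lo n <= lo (k + n)%nat).
{ intros n k; induction k as [|k IH]; simpl; [lra|].
  apply Rle_trans with (1 := IH); apply Rlt_le, Hstep. }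
assert (Hhi : forall n k, hi (k + n)%nat <= hi n).
{ intros n k; induction k as [|k IH]; simpl; [lra|].
  apply Rle_trans with (2 := IH); apply Rlt_le, Hstep. }
assert (Hcross : forall n k, lo n <= hi k).
{ intros n k; apply Rle_trans with (1 := Hlo n k).
  rewrite Nat.add_comm; apply Rle_trans with (2 := Hhi k n).
  apply Rlt_le, Hlohi. }
destruct (completeness (fun x => exists n, x = lo n)) as [x [Hub Hlub]].
{ exists (hi 0%nat); intros y [n ->]; apply Hcross. }
{ exists (lo 0%nat); now exists 0%nat. }
assert (Hx : forall n, lo n < x < hi n).
{ intros n; destruct (Hstep n) as [H1 [H2 _]]; split.
  - apply Rlt_le_trans with (1 := H1); apply Hub; now exists (S n).
  - apply Rle_lt_trans with (2 := H2); apply Hlub; intros y [k ->]; apply Hcross. }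
exists x; split.
{ assert (H := Hx 0%nat); unfold lo, hi in H; simpl in H; lra. }
intros eps Heps.
(* y and x are both compared with the left endpoint of an interval, and the
   quasi-triangle inequality costs a factor 2: hence eps / 4. *)
destruct (archimed_cor1 (eps / 4)) as [N [HN HN0]]; [lra|].
destruct N as [|N]; [lia|].
assert (HxN := Hx (S N)); destruct (Hstep N) as [_ [_ HD]].
exists (Rmin (x - lo (S N)) (hi (S N) - x)); split.
{ apply Rmin_glb_lt; lra. }
intros y Hy.
assert (Hy1 := Rlt_le_trans _ _ _ Hy (Rmin_l _ _)).
assert (Hy2 := Rlt_le_trans _ _ _ Hy (Rmin_r _ _)).
apply Rabs_def2 in Hy1; apply Rabs_def2 in Hy2.
assert (Hl := Hlohi (S N)).
apply Rle_lt_trans with (1 := Dtri y x (lo (S N)) ltac:(lra) ltac:(lra) ltac:(lra)).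
rewrite (Dsym _ x).
assert (HDx := HD x HxN); assert (HDy := HD y ltac:(lra)); lra.
Qed.

(** Left continuity usually rests on a locally uniform bound for the norms of
    T(t). Instead, take a point of continuity x in (0, s): the single bounded
    operator T(s - x) carries continuity at x to continuity at s. *)
Lemma orbit_left_continuous T u s eps : C0_semigroup T -> ell2 u -> 0 < s ->
  0 < eps ->
  exists d, 0 < d <= s /\ forall h, 0 < h < d -> dist2 (T (s - h) u) (T s u) < eps.
Proof.
intros HT Hu Hs Heps.
assert (Hl : forall x, 0 <= x -> ell2 (T x u))
  by (intros x Hx; now apply semigroup_ell2).
destruct (continuity_point_of_right_continuous
  (fun x y => dist2 (T x u) (T y u)) s) as [x [Hx Hcont]].
- intros; apply dist2_sym.
- intros; apply dist2_quasi_triangle; apply Hl; lra.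
- intros x e H He; apply orbit_right_continuous; trivial; lra.
- exact Hs.
- destruct (bounded_linear_pos_bound (T (s - x))) as [M [HM0 HM]].
  { apply HT; lra. }
  destruct (Hcont (eps / M)) as [d [Hd0 Hd]]; [now apply Rdiv_lt_0_compat|].
  exists (Rmin d x); split.
  { split; [apply Rmin_glb_lt; lra|].
    apply Rle_trans with (1 := Rmin_r _ _); lra. }
  intros h Hh.
  assert (H1 := Rlt_le_trans _ _ _ (proj2 Hh) (Rmin_l _ _)).
  assert (H2 := Rlt_le_trans _ _ _ (proj2 Hh) (Rmin_r _ _)).
  replace (s - h) with ((s - x) + (x - h)) by ring.
  replace (T s u) with (T ((s - x) + x) u) by (f_equal; ring).
  rewrite !semigroup_add by (try assumption; lra).
  unfold dist2; rewrite <- bounded_linear_minus;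
    [|apply HT; lra|apply Hl; lra|apply Hl; lra].
  apply Rle_lt_trans with (1 := HM _ (ell2_minus _ _ (Hl (x - h) ltac:(lra))
    (Hl x ltac:(lra)))).
  apply Rlt_le_trans with (M * (eps / M)); [|right; field; lra].
  apply Rmult_lt_compat_l; [exact HM0|]; apply Hd.
  replace (x - h - x) with (- h) by ring.
  rewrite Rabs_Ropp, Rabs_right; lra.
Qed.

(** T(s) commutes with the difference quotients of the semigroup. *)
Lemma generator_invariant T s u v : C0_semigroup T -> 0 <= s ->
  generator T u v -> generator T (T s u) (T s v).
Proof.
intros HT Hs [Hu [Hv Hlim]].
assert (HB := proj1 HT s Hs).
split; [now apply semigroup_ell2|split; [now apply semigroup_ell2|]].
apply right_limit_0; [intros; apply norm2_ge0|].
assert (Hlim' := proj1 (right_limit_0 _ (fun h => norm2_ge0 _)) Hlim).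
destruct (bounded_linear_pos_bound _ HB) as [M [HM0 HM]].
intros eps Heps.
destruct (Hlim' (eps / M)) as [d [Hd0 Hd]]; [now apply Rdiv_lt_0_compat|].
exists d; split; [exact Hd0|]; intros h Hh.
assert (Hhu := semigroup_ell2 T h u HT ltac:(lra) Hu).
set (q := (fun k => RtoC (/ h) * (T h u k - u k))%C).
assert (Hq : ell2 q) by now apply ell2_scal, ell2_minus.
assert (Ediv : forall x : C, (x / RtoC h = RtoC (/ h) * x)%C).
{ intros x; unfold Cdiv; rewrite RtoC_inv; [ring|lra]. }
replace (fun k => ((T h (T s u) k - T s u k) / RtoC h - T s v k)%C) with
  (T s (fun k => q k - v k)%C).
- apply Rle_lt_trans with (1 := HM _ (ell2_minus _ _ Hq Hv)).
  apply Rlt_le_trans with (M * (eps / M)); [|right; field; lra].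
  apply Rmult_lt_compat_l; [exact HM0|].
  replace (fun k => q k - v k)%C with
    (fun k => (T h u k - u k) / RtoC h - v k)%C; [now apply Hd|].
  apply functional_extensionality; intros k; unfold q; now rewrite Ediv.
- rewrite bounded_linear_minus by assumption.
  unfold q; rewrite bounded_linear_scal by (trivial; now apply ell2_minus).
  rewrite bounded_linear_minus by assumption.
  apply functional_extensionality; intros k.
  rewrite <- !semigroup_add by (try assumption; lra).
  rewrite (Rplus_comm h s); now rewrite Ediv.
Qed.

(** For each eps, the set of s with |f(s) - f(0)| <= eps s contains its supremum
    by left continuity, and cannot stop before [t] because of the right
    derivative. *)
Lemma constant_of_right_derivative_0 (f : R -> R) t : 0 < t ->
  (forall s eps, 0 <= s < t -> 0 < eps -> exists d, 0 < d /\
     forall h, 0 < h < d -> Rabs (f (s + h) - f s) <= eps * h) ->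
  (forall s eps, 0 < s <= t -> 0 < eps -> exists d, 0 < d /\
     forall h, 0 < h < d -> Rabs (f (s - h) - f s) <= eps) ->
  f t = f 0.
Proof.
intros Ht Hright Hleft.
assert (Heps : forall eps, 0 < eps -> Rabs (f t - f 0) <= eps * t).
{ intros eps Heps.
  set (E := fun s => 0 <= s <= t /\ Rabs (f s - f 0) <= eps * s).
  destruct (completeness E) as [x [Hub Hlub]].
  { exists t; intros s Hs; apply Hs. }
  { exists 0; split; [lra|]. rewrite Rminus_diag, Rabs_R0; lra. }
  assert (Hx0 : 0 <= x).
  { apply Hub; split; [lra|]; rewrite Rminus_diag, Rabs_R0; lra. }
  assert (Hxt : x <= t) by (apply Hlub; intros s Hs; apply Hs).
  assert (HEx : E x).
  { split; [lra|].
    destruct (Req_dec x 0) as [->|Hxn0].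
    { rewrite Rminus_diag, Rabs_R0; lra. }
    apply le_epsilon; intros eta Heta.
    destruct (Hleft x eta ltac:(lra) Heta) as [d [Hd0 Hd]].
    destruct (classic (exists s, E s /\ x - d < s)) as [[s [Hs Hsd]]|Hn].
    2:{ exfalso; assert (x <= x - d); [|lra].
        apply Hlub; intros s Hs; apply Rnot_lt_le; intros Hlt; apply Hn.
        now exists s. }
    assert (Hsx := Hub s Hs); destruct Hs as [Hs1 Hs2].
    destruct (Req_dec s x) as [->|Hne]; [lra|].
    assert (H := Hd (x - s) ltac:(lra)).
    replace (x - (x - s)) with s in H by ring.
    assert (H' := Rabs_triang (f s - f 0) (- (f s - f x))).
    rewrite Rabs_Ropp in H'.
    replace (f s - f 0 + - (f s - f x)) with (f x - f 0) in H' by ring.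
    assert (eps * s <= eps * x) by (apply Rmult_le_compat_l; lra).
    lra. }
  destruct (Req_dec x t) as [<-|Hne]; [apply HEx|exfalso].
  destruct (Hright x eps ltac:(lra) Heps) as [d [Hd0 Hd]].
  set (h := Rmin (d / 2) (t - x)).
  assert (Hh : 0 < h /\ h < d /\ h <= t - x).
  { unfold h, Rmin; destruct Rle_dec; lra. }
  assert (H := Hd h ltac:(lra)).
  assert (x + h <= x); [|lra].
  apply Hub; split; [lra|].
  assert (H' := Rabs_triang (f (x + h) - f x) (f x - f 0)).
  replace (f (x + h) - f x + (f x - f 0)) with (f (x + h) - f 0) in H' by ring.
  destruct HEx as [_ HEx]; lra. }
apply Rminus_diag_uniq.
destruct (Req_dec (f t - f 0) 0) as [|Hne]; [trivial|exfalso].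
apply Rabs_pos_lt in Hne.
assert (H := Heps (Rabs (f t - f 0) / (2 * t)) ltac:(apply Rdiv_lt_0_compat; lra)).
replace (Rabs (f t - f 0) / (2 * t) * t) with (Rabs (f t - f 0) / 2) in H
  by (field; lra).
lra.
Qed.

(** * Evolution of coherent vectors *)

Lemma gen_plus alpha p u v z : -1 < alpha -> real_form p -> ell2 u -> ell2 v ->
  Rabs z < 1 ->
  gen alpha p (fun k => u k + v k)%C z = gen alpha p u z + gen alpha p v z.
Proof.
intros Ha Hp Hu Hv Hz; unfold gen; rewrite <- PSeries_plus;
  try (apply CV_radius_inside, disk_inside; [now apply radius_gen_coef|exact Hz]).
apply PSeries_ext; intros m; unfold gen_coef; rewrite (form_plus p Hp).
change (sigma alpha m * (p (u m) + p (v m)) =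
  sigma alpha m * p (u m) + sigma alpha m * p (v m)); ring.
Qed.

Lemma gen_scal alpha p r v z : real_form p ->
  gen alpha p (fun k => RtoC r * v k)%C z = r * gen alpha p v z.
Proof.
intros Hp; unfold gen; rewrite <- PSeries_scal.
apply PSeries_ext; intros m; unfold gen_coef; rewrite (form_scal p Hp).
change (sigma alpha m * (r * p (v m)) = r * (sigma alpha m * p (v m))); ring.
Qed.

(** The solution of z' = (1 - z)^2 with z(0) = 1 - 1/w. The characteristics of
    the operator in [gen_tau] are translations of w = 1 / (1 - z). *)
Definition flow (w r : R) : R := 1 - / (w + r).

(** [v] paired with e^(-rH) applied to the coherent vector of parameter
    1 - 1/w: the semigroup moves this parameter along [flow] and multiplies
    the vector by (w / (w + r))^(alpha + 1). *)
Definition pairing (alpha : R) (p : C -> R) (w r : R) (v : cseq) : R :=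
  Rpower (w / (w + r)) (alpha + 1) * gen alpha p v (flow w r).

(** The bound 1/2 < w says that 1 - 1/w lies in (-1, 1). *)
Lemma flow_in_disk w r : / 2 < w -> 0 <= r -> Rabs (flow w r) < 1.
Proof.
intros Hw Hr; unfold flow.
assert (H1 : 0 < / (w + r)) by (apply Rinv_0_lt_compat; lra).
assert (H2 : / (w + r) < 2).
{ rewrite <- (Rinv_inv 2); apply Rinv_lt_contravar; [|lra].
  apply Rmult_lt_0_compat; lra. }
apply Rabs_def1; lra.
Qed.

Lemma flow_uniformly_in_disk w t : / 2 < w -> 0 <= t ->
  exists rho, rho < 1 /\ forall r, 0 <= r <= t -> Rabs (flow w r) <= rho.
Proof.
intros Hw Ht; exists (Rmax (flow w t) (- flow w 0)); split.
{ assert (H1 := flow_in_disk w t Hw Ht).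
  assert (H2 := flow_in_disk w 0 Hw ltac:(lra)).
  apply Rabs_def2 in H1; apply Rabs_def2 in H2; apply Rmax_lub_lt; lra. }
intros r Hr.
assert (Hmono : forall a b, 0 <= a <= b -> flow w a <= flow w b).
{ intros a b Hab; unfold flow; assert (/ (w + b) <= / (w + a)); [|lra].
  apply Rinv_le_contravar; lra. }
assert (H1 := Hmono r t Hr); assert (H2 := Hmono 0 r ltac:(lra)).
assert (H3 := Rmax_l (flow w t) (- flow w 0)).
assert (H4 := Rmax_r (flow w t) (- flow w 0)).
apply Rabs_le; lra.
Qed.

Lemma pairing_bound alpha p w t : -1 < alpha -> real_form p -> / 2 < w -> 0 <= t ->
  exists K, 0 < K /\ forall r v, 0 <= r <= t -> ell2 v ->
    Rabs (pairing alpha p w r v) <= K * norm2 v.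
Proof.
intros Ha Hp Hw Ht.
destruct (flow_uniformly_in_disk w t Hw Ht) as [rho [Hrho1 Hrho]].
set (K := Series (fun m => sigma alpha m * rho ^ m)).
exists (Rmax K 1); split.
{ assert (H := Rmax_r K 1); lra. }
intros r v Hr Hv; unfold pairing; rewrite Rabs_mult.
rewrite <- (Rmult_1_l (_ * norm2 v)).
apply Rmult_le_compat; try apply Rabs_pos.
- rewrite Rabs_right by apply Rle_ge, Rlt_le, exp_pos.
  apply Rle_trans with (exp 0); [|rewrite exp_0; lra].
  apply Rnot_lt_le; intros Hlt; apply exp_lt_inv in Hlt.
  assert (Hln : ln (w / (w + r)) <= 0).
  { rewrite <- ln_1; apply ln_le; [apply Rdiv_lt_0_compat; lra|].
    apply Rmult_le_reg_r with (w + r); [lra|].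
    unfold Rdiv; rewrite Rmult_assoc, Rinv_l; lra. }
  assert (H := Rmult_le_pos (alpha + 1) (- ln (w / (w + r)))
    ltac:(lra) ltac:(lra)); lra.
- apply Rle_trans with (norm2 v * K).
  + apply gen_bound; try assumption; split; [now apply Hrho|exact Hrho1].
  + rewrite Rmult_comm; apply Rmult_le_compat_r; [apply norm2_ge0|apply Rmax_l].
Qed.

Lemma pairing_axpy alpha p w r h u v : -1 < alpha -> real_form p ->
  / 2 < w -> 0 <= r -> ell2 u -> ell2 v ->
  pairing alpha p w r (fun k => u k + RtoC h * v k)%C =
  pairing alpha p w r u + h * pairing alpha p w r v.
Proof.
intros Ha Hp Hw Hr Hu Hv; unfold pairing.
rewrite (gen_plus alpha p u (fun k => RtoC h * v k)%C), gen_scal;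
  trivial; [ring|now apply ell2_scal|now apply flow_in_disk].
Qed.

(** Transport along the characteristics of [gen_tau]: the derivatives of [flow]
    and of the scalar factor reproduce its two terms. In effect H is moved from
    the coherent vector to [v], so its symmetry enters here. *)
Lemma pairing_derive alpha p w r v : -1 < alpha -> real_form p ->
  / 2 < w -> 0 <= r -> ell2 v ->
  is_derive (fun r => pairing alpha p w r v) r
    (pairing alpha p w r (fun k => - tau alpha v k)%C).
Proof.
intros Ha Hp Hw Hr Hv; unfold pairing.
assert (Hz := flow_in_disk w r Hw Hr).
evar_last.
{ apply (is_derive_mult (fun r => Rpower (w / (w + r)) (alpha + 1))
    (fun r => gen alpha p v (flow w r))).
  - unfold Rpower; auto_derive; [|reflexivity].
    split; [lra|split; [apply Rdiv_lt_0_compat; lra|exact I]].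
  - apply (is_derive_comp (gen alpha p v) (flow w)).
    + apply is_derive_PSeries, disk_inside; [now apply radius_gen_coef|exact Hz].
    + unfold flow; auto_derive; [lra|reflexivity].
  - exact Rmult_comm. }
rewrite gen_tau by assumption.
unfold plus, mult, scal; simpl; unfold mult; simpl.
unfold Rpower.
set (D := PSeries (PS_derive (gen_coef alpha p v)) (flow w r)).
set (g := gen alpha p v (flow w r)).
unfold flow; unfold Rdiv; field; lra.
Qed.

Lemma pairing_first_order alpha p w r v eps : -1 < alpha -> real_form p ->
  / 2 < w -> 0 <= r -> ell2 v -> 0 < eps ->
  exists d, 0 < d /\ forall h, Rabs h < d ->
    Rabs (pairing alpha p w (r + h) v - pairing alpha p w r v -
      h * pairing alpha p w r (fun k => - tau alpha v k)%C) <= eps * Rabs h.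
Proof.
intros Ha Hp Hw Hr Hv Heps.
assert (H := pairing_derive alpha p w r v Ha Hp Hw Hr Hv).
apply is_derive_Reals in H.
destruct (H eps Heps) as [d Hd].
exists d; split; [apply cond_pos|]; intros h Hh.
destruct (Req_dec h 0) as [->|Hh0].
{ rewrite Rplus_0_r, Rabs_R0, Rmult_0_l, Rminus_diag, Rminus_0_r, Rabs_R0; lra. }
specialize (Hd h Hh0 Hh).
replace (_ - _ - _) with (((pairing alpha p w (r + h) v - pairing alpha p w r v) / h -
  pairing alpha p w r (fun k => - tau alpha v k)%C) * h) by (field; exact Hh0).
rewrite Rabs_mult; apply Rmult_le_compat_r; [apply Rabs_pos|now apply Rlt_le].
Qed.

Lemma pairing_continuous alpha p w r v eps : -1 < alpha -> real_form p ->
  / 2 < w -> 0 <= r -> ell2 v -> 0 < eps ->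
  exists d, 0 < d /\ forall h, Rabs h < d ->
    Rabs (pairing alpha p w (r + h) v - pairing alpha p w r v) < eps.
Proof.
intros Ha Hp Hw Hr Hv Heps.
assert (H : continuous (fun r => pairing alpha p w r v) r).
{ apply (ex_derive_continuous (fun r => pairing alpha p w r v)).
  eexists; now apply pairing_derive. }
destruct (proj1 (filterlim_locally _ _) H (mkposreal eps Heps)) as [d Hd].
exists d; split; [apply cond_pos|]; intros h Hh; apply (Hd (r + h)).
change (Rabs (r + h - r) < d); now replace (r + h - r) with h by ring.
Qed.

(** The pairing of T(s) u with the coherent vector evolved for the remaining time
    t - s does not depend on s: the derivatives of the two factors cancel. Only
    right derivatives of s |-> T(s) u are at hand, whence
    [constant_of_right_derivative_0] and [orbit_left_continuous]. *)
Lemma pairing_conserved alpha t T u v0 p w : -1 < alpha -> 0 < t ->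
  exp_semigroup (laguerre_operator alpha) T -> generator T u v0 ->
  real_form p -> / 2 < w ->
  pairing alpha p w 0 (T t u) = pairing alpha p w t u.
Proof.
intros Ha Ht [HT Hgen] Hu Hp Hw.
assert (Hu2 := proj1 Hu).
assert (Hl : forall x, 0 <= x -> ell2 (T x u))
  by (intros x Hx; now apply semigroup_ell2).
destruct (pairing_bound alpha p w t Ha Hp Hw ltac:(lra)) as [K [HK0 HK]].
assert (E := constant_of_right_derivative_0
  (fun s => pairing alpha p w (t - s) (T s u)) t Ht).
replace (pairing alpha p w t u) with (pairing alpha p w (t - 0) (T 0 u)).
2:{ rewrite Rminus_0_r; f_equal; apply functional_extensionality.
    intros n; now apply HT. }
replace 0 with (t - t) at 1 by ring.
apply E; clear E.
- intros s eps Hs Heps.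
  set (r := t - s).
  destruct (generator_invariant T s u v0 HT ltac:(lra) Hu) as [_ [Hq Hlim]].
  assert (Eq : T s v0 = (fun k => - tau alpha (T s u) k)%C).
  { apply functional_extensionality; intros k.
    apply (proj1 (Hgen (T s u) (T s v0))).
    apply generator_invariant; trivial; lra. }
  rewrite Eq in Hq, Hlim.
  set (q := (fun k => - tau alpha (T s u) k)%C) in *.
  assert (Hlim' := proj1 (right_limit_0 _ (fun h => norm2_ge0 _)) Hlim).
  assert (Hvs := Hl s ltac:(lra)).
  destruct (pairing_first_order alpha p w r (T s u) (eps / 3) Ha Hp Hw
    ltac:(unfold r; lra) Hvs ltac:(lra)) as [d1 [Hd10 Hd1]].
  fold q in Hd1.
  destruct (pairing_continuous alpha p w r q (eps / 3) Ha Hp Hw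
    ltac:(unfold r; lra) Hq ltac:(lra)) as [d2 [Hd20 Hd2]].
  destruct (Hlim' (eps / 3 / K)) as [d3 [Hd30 Hd3]].
  { apply Rdiv_lt_0_compat; lra. }
  exists (Rmin (Rmin d1 d2) (Rmin d3 r)); split.
  { repeat apply Rmin_glb_lt; trivial; unfold r; lra. }
  intros h [Hh0 Hh].
  assert (Hh12 := Rlt_le_trans _ _ _ Hh (Rmin_l _ _)).
  assert (Hh34 := Rlt_le_trans _ _ _ Hh (Rmin_r _ _)).
  assert (Hh1 := Rlt_le_trans _ _ _ Hh12 (Rmin_l _ _)).
  assert (Hh2 := Rlt_le_trans _ _ _ Hh12 (Rmin_r _ _)).
  assert (Hh3 := Rlt_le_trans _ _ _ Hh34 (Rmin_l _ _)).
  assert (Hh4 := Rlt_le_trans _ _ _ Hh34 (Rmin_r _ _)).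
  assert (Habs : Rabs (- h) = h) by (rewrite Rabs_Ropp, Rabs_right; lra).
  specialize (Hd1 (- h)); specialize (Hd2 (- h)); rewrite Habs in Hd1, Hd2.
  specialize (Hd1 Hh1); specialize (Hd2 Hh2); specialize (Hd3 h (conj Hh0 Hh3)).
  set (e := (fun k => (T h (T s u) k - T s u k) / RtoC h - q k)%C) in *.
  assert (He : ell2 e).
  { apply ell2_minus; [|exact Hq].
    replace (fun k => (T h (T s u) k - T s u k) / RtoC h)%C with
      (fun k => / RtoC h * (T h (T s u) k - T s u k))%C.
    - apply ell2_scal, ell2_minus; [|exact Hvs].
      apply semigroup_ell2; trivial; lra.
    - apply functional_extensionality; intros k; unfold Cdiv; ring. }
  assert (Hsplit : T (s + h) u =
    (fun k => (T s u k + RtoC h * q k) + RtoC h * e k)%C).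
  { rewrite Rplus_comm, semigroup_add by (trivial; lra).
    apply functional_extensionality; intros k; unfold e; field.
    intros H; apply RtoC_inj in H; lra. }
  replace (t - (s + h)) with (r + - h) by (unfold r; ring).
  rewrite Hsplit.
  rewrite (pairing_axpy alpha p w (r + - h) h (fun k => T s u k + RtoC h * q k)%C e);
    trivial; try lra; [|now apply ell2_plus, ell2_scal].
  rewrite (pairing_axpy alpha p w (r + - h) h (T s u) q); trivial; try lra.
  assert (HKe := HK (r + - h) e ltac:(unfold r in *; lra) He).
  assert (HKe' : Rabs (pairing alpha p w (r + - h) e) <= eps / 3).
  { apply Rle_trans with (1 := HKe).
    apply Rle_trans with (K * (eps / 3 / K)); [|right; field; lra].
    apply Rmult_le_compat_l; [lra|exact (Rlt_le _ _ Hd3)]. }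
  set (A1 := pairing alpha p w (r + - h) (T s u) - pairing alpha p w r (T s u) -
    - h * pairing alpha p w r q) in *.
  set (A2 := pairing alpha p w (r + - h) q - pairing alpha p w r q) in *.
  set (A3 := pairing alpha p w (r + - h) e) in *.
  (* A1: the coherent vector moves; A2: its displacement is tested against q;
     A3: error of the difference quotient of the semigroup *)
  replace (_ - _) with (A1 + h * (A2 + A3)) by (unfold A1, A2; ring).
  apply Rle_trans with (1 := Rabs_triang _ _).
  rewrite Rabs_mult, (Rabs_right h) by lra.
  assert (H23 := Rabs_triang A2 A3).
  assert (h * Rabs (A2 + A3) <= h * (eps / 3 + eps / 3)).
  { apply Rmult_le_compat_l; lra. }
  lra.
- intros s eps Hs Heps.
  set (r := t - s).
  assert (Hvs := Hl s ltac:(lra)).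
  destruct (pairing_continuous alpha p w r (T s u) (eps / 2) Ha Hp Hw
    ltac:(unfold r; lra) Hvs ltac:(lra)) as [d1 [Hd10 Hd1]].
  destruct (orbit_left_continuous T u s (eps / 2 / K) HT Hu2 ltac:(lra))
    as [d2 [Hd20 Hd2]].
  { apply Rdiv_lt_0_compat; lra. }
  exists (Rmin d1 d2); split; [apply Rmin_glb_lt; lra|].
  intros h [Hh0 Hh].
  assert (Hh1 := Rlt_le_trans _ _ _ Hh (Rmin_l _ _)).
  assert (Hh2 := Rlt_le_trans _ _ _ Hh (Rmin_r _ _)).
  specialize (Hd2 h (conj Hh0 Hh2)).
  specialize (Hd1 h ltac:(rewrite Rabs_right; lra)).
  replace (t - (s - h)) with (r + h) by (unfold r; ring).
  set (e := (fun k => T (s - h)%R u k - T s u k)%C).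
  assert (He : ell2 e) by (apply ell2_minus; trivial; apply Hl; lra).
  replace (T (s - h) u) with (fun k => T s u k + RtoC 1 * e k)%C.
  2:{ apply functional_extensionality; intros k; unfold e; ring. }
  rewrite pairing_axpy; trivial; [|unfold r; lra].
  assert (HKe := HK (r + h) e ltac:(unfold r in *; lra) He).
  assert (HKe' : Rabs (pairing alpha p w (r + h) e) <= eps / 2).
  { apply Rle_trans with (1 := HKe).
    apply Rle_trans with (K * (eps / 2 / K)); [|right; field; lra].
    apply Rmult_le_compat_l; [lra|]; now apply Rlt_le. }
  rewrite Rmult_1_l.
  replace (_ - _) with ((pairing alpha p w (r + h) (T s u) -
    pairing alpha p w r (T s u)) + pairing alpha p w (r + h) e) by ring.
  apply Rle_trans with (1 := Rabs_triang _ _); lra.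
Qed.

(** * The kernel *)

Lemma ell2_finite_support u N : (forall k, (N <= k)%nat -> u k = RtoC 0) -> ell2 u.
Proof.
intros H; apply (ex_series_incr_n (V := R_NormedModule) _ N).
apply ex_series_ext with (fun _ => 0).
{ intros k; rewrite H by lia; rewrite Cmod_0; simpl; ring. }
exists 0; change (is_lim_seq (sum_n (fun _ : nat => 0)) 0).
apply is_lim_seq_ext with (fun _ => 0); [|apply is_lim_seq_const].
intros n; induction n as [|n IH]; [now rewrite sum_O|].
rewrite sum_Sn, <- IH; symmetry; apply Rplus_0_l.
Qed.

Lemma delta_neq n k : k <> n -> delta n k = RtoC 0.
Proof. intros H; unfold delta; now rewrite (proj2 (Nat.eqb_neq k n) H). Qed.

Lemma delta_eq n : delta n n = RtoC 1.
Proof. unfold delta; now rewrite Nat.eqb_refl. Qed.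

Lemma delta_in_domain alpha n : dom (laguerre_operator alpha) (delta n).
Proof.
split.
- apply ell2_finite_support with (S n); intros k Hk; apply delta_neq; lia.
- apply ell2_finite_support with (S (S n)); intros k Hk; unfold tau.
  destruct k as [|k]; [lia|].
  rewrite !delta_neq by lia; ring.
Qed.

Lemma kernel_coordinate B n m : kernel B n m = B (delta n) m.
Proof.
unfold kernel, inner; apply injective_projections; cbn [fst snd].
- rewrite (is_series_unique _ _ (Series_single
    (fun k => Re (B (delta n) k * Cconj (delta m k))%C) m
    ltac:(intros k Hk; cbv beta; rewrite delta_neq by exact Hk; simpl; ring))).
  rewrite delta_eq; simpl; ring.
- rewrite (is_series_unique _ _ (Series_single
    (fun k => Im (B (delta n) k * Cconj (delta m k))%C) m
    ltac:(intros k Hk; cbv beta; rewrite delta_neq by exact Hk; simpl; ring))).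
  rewrite delta_eq; simpl; ring.
Qed.

(** The kernel in the form that makes its symmetry and its regularity at t = 1
    visible. *)
Definition heat_kernel (alpha : R) (n m : nat) (t : R) : R :=
  sigma alpha n * sigma alpha m * Rpower (1 + t) (- (alpha + 1)) *
  (t / (1 + t)) ^ (n + m) * hyp n (- INR m) (alpha + 1) (/ t ^ 2).

Lemma heat_kernel_sym alpha n m t : heat_kernel alpha n m t = heat_kernel alpha m n t.
Proof. unfold heat_kernel; rewrite hyp_sym, (Nat.add_comm n m); ring. Qed.

Lemma gen_delta alpha p n z : real_form p ->
  gen alpha p (delta n) z = sigma alpha n * p (RtoC 1) * z ^ n.
Proof.
intros Hp; unfold gen, PSeries.
rewrite (is_series_unique _ _ (Series_single
  (fun k => gen_coef alpha p (delta n) k * z ^ k) n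
  ltac:(intros k Hk; unfold gen_coef; rewrite delta_neq by exact Hk;
    replace (RtoC 0) with (RtoC 0 * 0)%C by ring;
    rewrite (form_scal p Hp); ring))).
unfold gen_coef; now rewrite delta_eq.
Qed.

Lemma radius_pos (a : nat -> R) x : x <> 0 -> ex_pseries a x ->
  Rbar_lt 0 (CV_radius a).
Proof.
intros Hx Ha; apply Rbar_lt_le_trans with (Rabs x); [now apply Rabs_pos_lt|].
apply Rbar_not_lt_le; intros Hlt; apply (CV_disk_outside a x Hlt).
apply ex_series_lim_0; now apply ex_pseries_R.
Qed.

(** Applied to [delta n], the conservation law says that
    sum_m sigma_m T(t) delta_n(m) z^m = (w / (w + t))^c sigma_n z(t)^n, with
    c = alpha + 1 and z(t) = [flow w t]. With s = t / (1 + t) and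
    x = 1 / t^2 the right-hand side is a constant times the Meixner generating
    function at X = s z, so the coefficients can be compared. *)
Lemma form_kernel alpha t T p n m : -1 < alpha -> 0 < t ->
  exp_semigroup (laguerre_operator alpha) T -> real_form p ->
  p (T t (delta n) m) = p (RtoC 1) * heat_kernel alpha n m t.
Proof.
intros Ha Ht HT Hp.
set (s := t / (1 + t)).
assert (Hs : 0 < s < 1).
{ split; [apply Rdiv_lt_0_compat; lra|].
  apply Rmult_lt_reg_r with (1 + t); [lra|].
  unfold s, Rdiv; rewrite Rmult_assoc, Rinv_l; lra. }
set (x := / t ^ 2).
set (K0 := p (RtoC 1) * sigma alpha n * Rpower (1 + t) (- (alpha + 1)) * s ^ n).
set (b := fun m => K0 *
  (binom_coef (alpha + 1) m * hyp n (- INR m) (alpha + 1) x * s ^ m)).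
assert (Hb : forall z, Rabs z < / 2 ->
  is_pseries b z (gen alpha p (T t (delta n)) z)).
{ intros z Hz; apply Rabs_def2 in Hz.
  set (w := / (1 - z)).
  assert (Hw : / 2 < w).
  { unfold w; apply Rinv_lt_contravar; lra. }
  assert (Hgen : generator T (delta n) (fun k => - tau alpha (delta n) k)%C).
  { apply (proj2 HT); split; [apply delta_in_domain|reflexivity]. }
  assert (HX : Rabs (s * z) < 1).
  { rewrite Rabs_mult, (Rabs_right s) by lra.
    assert (H : Rabs z < 1) by (apply Rabs_def1; lra).
    assert (H' := Rabs_pos z); nra. }
  assert (HX1 : s * z < 1) by (apply Rabs_def2 in HX; lra).
  assert (E := pairing_conserved alpha t T _ _ p w Ha Ht HT Hgen Hp Hw).
  assert (Ew : w = / (1 - z)) by reflexivity.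
  assert (Ef0 : flow w 0 = z).
  { unfold flow; rewrite Rplus_0_r, Ew, Rinv_inv; ring. }
  assert (Ewt : w + t = (1 + t) * (1 - s * z) / (1 - z)).
  { rewrite Ew; unfold s; field; lra. }
  unfold pairing in E; rewrite Ef0, Rplus_0_r in E.
  rewrite gen_delta in E by exact Hp.
  replace (w / w) with 1 in E by (field; lra).
  replace (Rpower 1 (alpha + 1)) with 1 in E
    by (unfold Rpower; rewrite ln_1, Rmult_0_r, exp_0; reflexivity).
  rewrite Rmult_1_l in E; rewrite E.
  replace (Rpower (w / (w + t)) (alpha + 1)) with
    (Rpower (1 + t) (- (alpha + 1)) * Rpower (1 - s * z) (- (alpha + 1))).
  2:{ rewrite Rpower_mult_distr by lra.
      replace (w / (w + t)) with (/ ((1 + t) * (1 - s * z))).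
      - unfold Rpower; rewrite ln_Rinv; [f_equal; ring|].
        apply Rmult_lt_0_compat; lra.
      - rewrite Ewt, Ew; field; lra. }
  replace (flow w t) with (s * (1 + x * (s * z) / (1 - s * z))).
  2:{ unfold flow; rewrite Ewt; unfold x, s; field.
      assert (H : (1 - s * z) * (1 + t) = 1 + t - t * z)
        by (unfold s; field; lra).
      repeat split; try lra.
      assert (0 < (1 - s * z) * (1 + t)) by (apply Rmult_lt_0_compat; lra).
      lra. }
  apply is_pseries_R.
  assert (H := meixner_generating_function n (alpha + 1) x (s * z)
    ltac:(lra) HX).
  apply is_pseries_R, (is_series_scal_l (V := R_NormedModule) K0) in H.
  evar_last; [apply is_series_ext with (2 := H)|].
  - intros k; unfold b.
    match goal with |- scal ?a ?b = ?c => change (a * b = c :> R) end.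
    rewrite Rpow_mult_distr; ring.
  - match goal with |- scal ?a ?b = ?c => change (a * b = c :> R) end.
    unfold K0; rewrite Rpow_mult_distr; ring. }
assert (Eab : gen_coef alpha p (T t (delta n)) m = b m).
{ apply PSeries_ext_recip.
  - apply Rbar_lt_le_trans with 1; [simpl; lra|].
    apply radius_gen_coef; trivial.
    apply semigroup_ell2; [apply HT|lra|apply (delta_in_domain alpha)].
  - apply radius_pos with (/ 4); [lra|].
    eexists; apply Hb; rewrite Rabs_right; lra.
  - exists (mkposreal (/ 2) ltac:(lra)); intros z Hz.
    change (Rabs (z - 0) < / 2) in Hz; rewrite Rminus_0_r in Hz.
    symmetry; apply is_pseries_unique, Hb, Hz. }
unfold gen_coef, b in Eab.
assert (Hsm := sigma_pos alpha m Ha).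
apply Rmult_eq_reg_l with (sigma alpha m); [|lra].
rewrite Eab, <- sigma_sqr by exact Ha.
unfold K0, heat_kernel; fold s x; rewrite pow_add; ring.
Qed.

Lemma kernel_closed_form alpha t T n m : -1 < alpha -> 0 < t ->
  exp_semigroup (laguerre_operator alpha) T ->
  kernel (T t) n m = RtoC (heat_kernel alpha n m t).
Proof.
intros Ha Ht HT; rewrite kernel_coordinate; apply injective_projections.
- assert (H := form_kernel alpha t T Re n m Ha Ht HT real_form_Re).
  simpl in H |- *; rewrite Rmult_1_l in H; exact H.
- assert (H := form_kernel alpha t T Im n m Ha Ht HT real_form_Im).
  simpl in H |- *; rewrite Rmult_0_l in H; exact H.
Qed.

(** Pfaff's transformation at y = 1 / t^2, since
    (1 - (t^2 + 1) / (t^2 - 1)) / 2 = 1 / (1 - t^2) = y / (y - 1). *)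
Lemma kernel_formula_eq alpha n m t : -1 < alpha -> 0 < t -> t <> 1 ->
  kernel_formula alpha n m t = heat_kernel alpha n m t.
Proof.
intros Ha Ht Ht1; unfold kernel_formula, heat_kernel.
assert (Hsn := sigma_pos alpha n Ha).
assert (Ht2 : t ^ 2 - 1 <> 0).
{ intros H; assert (Hf : (t - 1) * (t + 1) = 0) by (rewrite <- H; ring).
  apply Rmult_integral in Hf; lra. }
set (y := / t ^ 2).
assert (Hy : y <> 1).
{ unfold y; intros H; apply Ht2.
  replace (t ^ 2) with (/ / t ^ 2) by (rewrite Rinv_inv; reflexivity).
  rewrite H; field. }
replace (jacobi n alpha (INR m - INR n) ((t ^ 2 + 1) / (t ^ 2 - 1))) with
  (sigma alpha n * sigma alpha n *
   hyp n (INR m + alpha + 1) (alpha + 1) (y / (y - 1))).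
2:{ rewrite sigma_sqr by exact Ha; unfold jacobi, hyp, hyp_term, binom_coef.
    f_equal; apply sum_eq; intros k _.
    replace (INR n + alpha + (INR m - INR n) + 1) with (INR m + alpha + 1) by ring.
    replace ((1 - (t ^ 2 + 1) / (t ^ 2 - 1)) / 2) with (y / (y - 1));
      [reflexivity|].
    unfold y; field; lra. }
replace (- INR m) with (alpha + 1 - (INR m + alpha + 1)) by ring.
rewrite <- (hyp_pfaff n (INR m + alpha + 1) (alpha + 1) y) by lra.
unfold Z.sub; rewrite powerRZ_add, powerRZ_neg', <- !pow_powerRZ.
2:{ apply Rgt_not_eq, Rdiv_lt_0_compat; lra. }
rewrite Rpower_Ropp, pow_add.
replace (1 + alpha) with (alpha + 1) by ring.
replace (t / (1 + t)) with (t / (t + 1)) by (f_equal; ring).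
set (s := t / (t + 1)).
assert (Hs : 0 < s) by (apply Rdiv_lt_0_compat; lra).
replace (((t - 1) / (t + 1)) ^ n) with (s ^ n * (s ^ n * (1 - y) ^ n)).
2:{ rewrite <- !Rpow_mult_distr; f_equal; unfold s, y; field; lra. }
assert (Hsn' := pow_lt s n Hs).
assert (HR := exp_pos ((alpha + 1) * ln (1 + t))).
fold (Rpower (1 + t) (alpha + 1)) in HR.
field; lra.
Qed.

Lemma heat_kernel_continuous alpha n m t : 0 < t ->
  continuous (heat_kernel alpha n m) t.
Proof.
intros Ht; unfold heat_kernel.
apply (continuous_mult (K := R_AbsRing)
  (fun t => sigma alpha n * sigma alpha m * Rpower (1 + t) (- (alpha + 1)) *
    (t / (1 + t)) ^ (n + m))
  (fun t => hyp n (- INR m) (alpha + 1) (/ t ^ 2))).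
- apply (ex_derive_continuous (fun t => sigma alpha n * sigma alpha m *
    Rpower (1 + t) (- (alpha + 1)) * (t / (1 + t)) ^ (n + m))).
  unfold Rpower; auto_derive; lra.
- apply (continuous_comp (fun t => / t ^ 2)); [|apply continuous_hyp].
  apply (ex_derive_continuous (fun t => / t ^ 2)); auto_derive.
  assert (H := pow_lt t 2 Ht); simpl in H; lra.
Qed.

Theorem theorem4p1 (alpha t : R) (T : R -> cseq -> cseq)
  (Halpha : -1 < alpha) (Ht : 0 < t)
  (HT : exp_semigroup (laguerre_operator alpha) T) (n m : nat) :
  kernel (T t) n m = kernel (T t) m n /\
  exists r : R, value_extended_at_1 (kernel_formula alpha n m) t r /\
    kernel (T t) n m = RtoC r.
Proof.
split.
{ rewrite !(kernel_closed_form alpha) by assumption; f_equal.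
  apply heat_kernel_sym. }
exists (heat_kernel alpha n m t); split; [split|].
- intros Ht1; symmetry; now apply kernel_formula_eq.
- intros ->.
  apply is_lim_ext_loc with (heat_kernel alpha n m).
  + exists (mkposreal 1 Rlt_0_1); intros y Hy Hy1.
    change (Rabs (y - 1) < 1) in Hy; apply Rabs_def2 in Hy.
    symmetry; apply kernel_formula_eq; trivial; lra.
  + apply is_lim_continuity, continuity_pt_filterlim.
    apply heat_kernel_continuous; lra.
- now apply kernel_closed_form.
Qed.
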